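(* Let $\Delta > 0$ and $p > 0$, and let $\{I_k\}_{k\ge 1}$ be the sequence of change indicators of a page with change rate $\Delta$ and crawling rate $p$ (as defined in the context). Let $\{\eta_k\}_{k \ge 0}$ be a (deterministic) sequence of positive real numbers, let $y_0 \in \mathbb{R}$, and define the SA estimator, for $k \geq 0$, by $$y_{k+1} = y_k + \eta_k\left[I_{k+1}(y_k + p) - y_k\right].$$ 1. If $\sum_{k=0}^\infty \eta_k = \infty$ and $\sum_{k=0}^\infty \eta_k^2 < \infty$, then $\lim_{k\to\infty} y_k = \Delta$ almost surely. 2. If $\eta_k = 1/(k+1)^\gamma$ for all $k \ge 0$, with $\gamma \in (0,1)$, then, as $k \to \infty$, $$\mathbb{E}|y_k - \Delta| = O\left(k^{-\gamma/2}\right).$$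
   Context: Setup: a single page changes at the points of a homogeneous Poisson point process on $[0,\infty)$ with constant rate $\Delta$. Independently of this process, the page is crawled at random times $0 = t_0 < t_1 < t_2 < \cdots$, where the inter-arrival times $\{t_k - t_{k-1}\}_{k \ge 1}$ are iid exponential random variables with rate $p$. For $k \ge 1$, the change indicator is $I_k = 1$ if the page changed at least once in $(t_{k-1}, t_k]$ (i.e., the change process has at least one point in this interval), and $I_k = 0$ otherwise. The implied constant in $O(\cdot)$ does not depend on $k$ (it may depend on $\Delta$, $p$, $\gamma$ and $y_0$). *)

(* Defs.v *)
From HB Require Import structures.
From mathcomp Require Import all_boot all_order all_algebra.
From mathcomp Require Import finmap.
From mathcomp Require Import all_classical all_reals all_analysis.

Set Implicit Arguments.
Unset Strict Implicit.
Unset Printing Implicit Defensive.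
Import Order.TTheory GRing.Theory Num.Theory.
Import numFieldNormedType.Exports.

Local Open Scope classical_set_scope.
Local Open Scope ring_scope.

Section independence.
Context d (T : measurableType d) (R : realType) (P : probability T R).

Definition mutually_independent (I : choiceType) d' (T' : measurableType d')
    (X : I -> T -> T') : Prop :=
  forall (J : {fset I}) (B : I -> set T'),
    (forall i, i \in J -> measurable (B i)) ->
    P (\bigcap_(i in [set` J]) (X i @^-1` B i)) =
    (\prod_(i <- J) P (X i @^-1` B i))%E.

Definition sigma_generated (I : Type) (D : set I) d' (T' : measurableType d')
    (X : I -> T -> T') : set (set T) :=
  <<s \bigcup_(i in D) preimage_set_system [set: T] (X i) measurable >>.

Definition independent_systems (F G : set (set T)) : Prop :=
  forall A B, F A -> G B -> P (A `&` B) = (P A * P B)%E.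

End independence.

Section crawling.
Context d (T : measurableType d) (R : realType) (P : probability T R).

(* A simple point process on [0, +oo[ is represented by its random set of
   points [Phi : T -> set R]. *)
Definition bounded_borel : set (set R) :=
  [set A | measurable A /\ exists b : R, A `<=` `[0, b]].

(* [fset_set] sends infinite sets to the empty finite set; for a locally finite
   [Phi] and a bounded [A] the count below is the true number of points. *)
Definition npoints (Phi : T -> set R) (A : set R) (w : T) : nat :=
  #|` fset_set (Phi w `&` A)|.

(* The second argument of [poisson_prob] is ignored by the library; with a null
   parameter (i.e., when [A] is Lebesgue-negligible) it is the Dirac measure
   at 0. *)
Record poisson_point_process (Delta : R) (Phi : T -> set R) : Prop := {
  ppp_nonneg : forall w, Phi w `<=` `[0, +oo[ ;
  ppp_locally_finite : forall w (b : R), finite_set (Phi w `&` `[0, b]) ;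
  ppp_measurable : forall A, bounded_borel A ->
    measurable_fun [set: T] (npoints Phi A) ;
  ppp_poisson : forall A, bounded_borel A -> forall B : set nat,
    P (npoints Phi A @^-1` B) =
    poisson_prob (Delta * fine (lebesgue_measure A)) 0%N B ;
  ppp_independent : forall (n : nat) (A : 'I_n -> set R),
    (forall i, bounded_borel (A i)) -> trivIset [set: 'I_n] A ->
    mutually_independent P (fun i => npoints Phi (A i)) }.

Record crawl_times (p : R) (t : nat -> {RV P >-> R}) : Prop := {
  crawl_start : forall w, t 0%N w = 0 ;
  crawl_increasing : forall k w, t k w < t k.+1 w ;
  crawl_exponential : forall k (B : set R), measurable B ->
    P ((fun w => t k.+1 w - t k w) @^-1` B) = exponential_prob p B ;
  crawl_independent :
    mutually_independent P (fun k w => t k.+1 w - t k w) }.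

Record page_crawl_model (Delta p : R) (Phi : T -> set R)
    (t : nat -> {RV P >-> R}) : Prop := {
  model_changes : poisson_point_process Delta Phi ;
  model_crawls : crawl_times p t ;
  model_independent : independent_systems P
    (sigma_generated bounded_borel (npoints Phi))
    (sigma_generated [set: nat] (fun k => t k : T -> R)) }.

(* Meaningful for [k >= 1]. *)
Definition change_indicator (Phi : T -> set R) (t : nat -> {RV P >-> R})
    (k : nat) : T -> R :=
  \1_[set w | Phi w `&` `]t k.-1 w, t k w] !=set0].

End crawling.

Fixpoint sa_estimator (R : realType) (p : R) (eta : nat -> R) (y0 : R)
    (I : nat -> R) (k : nat) : R :=
  if k is k'.+1 then
    let y := sa_estimator p eta y0 I k' in
    y + eta k' * (I k'.+1 * (y + p) - y)
  else y0.

(* Main.v *)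
(** The change indicators are iid Bernoulli with parameter
    [q = Delta / (Delta + p)]: rounding every inter-arrival time up to a multiple
    of [h] makes the crawl times discrete, so conditioning on them is a countable
    sum and the indicators become independent with an explicit geometric series
    as parameter; as [h] tends to 0 the rounded indicators are eventually equal
    to the true ones, because the page changes finitely often in bounded time.

    With [z = y - Delta] the recursion reads
    [z_{k+1} = (1 - eta_k (1 - I)) z_k + (Delta + p) eta_k (I - q)].
    If [eta] is square summable, the noise series converges almost surely
    (Kolmogorov's maximal inequality), hence
    [sum eta_k (1 - I) = (1 - q) sum eta_k - sum eta_k (I - q)] diverges, and
    [z] tends to 0 by a deterministic argument. For the rate, the second moment [V]
    of [z] satisfies [V_{k+1} <= (1 - 2 a eta_k + c eta_k^2) V_k + c eta_k^2] with
    [a = 1 - q], which gives [V_k = O(eta_k)]. *)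
Require Import Defs.
From mathcomp Require Import all_boot all_order all_algebra.
From mathcomp Require Import finmap.
From mathcomp Require Import all_classical all_reals all_analysis.
From mathcomp Require Import measurable_realfun ring lra.
Set Implicit Arguments.
Unset Strict Implicit.
Unset Printing Implicit Defensive.
Import Order.TTheory GRing.Theory Num.Theory.
Import numFieldNormedType.Exports.
Local Open Scope classical_set_scope.
Local Open Scope ring_scope.

(** * Void probabilities of the Poisson process *)

(** Replaces the finite set of indices by a duplicate-free list, so that [enum] and [iota] can index
    the product. *)
Lemma mutually_independent_seq d (T : measurableType d) (R : realType)
    (P : probability T R) (I : choiceType) d' (T' : measurableType d')
    (X : I -> T -> T') (s : seq I) (B : I -> set T') :
  mutually_independent P X -> uniq s ->
  (forall i, i \in s -> measurable (B i)) ->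
  P [set w | forall i, i \in s -> B i (X i w)] =
  (\prod_(i <- s) P (X i @^-1` B i))%E.
Proof.
move=> indep us mB.
have inE' i : (i \in [fset j in s]%fset) = (i \in s) by rewrite !inE.
rewrite (_ : [set w | _] =
    \bigcap_(i in [set` [fset j in s]%fset]) (X i @^-1` B i)); last first.
  apply/seteqP; split=> w H i /= si; apply: H.
    by rewrite -inE'.
  by rewrite /= inE'.
rewrite indep => [|i]; last by rewrite inE'; exact: mB.
apply: perm_big; apply: uniq_perm => //.
Qed.

Lemma poisson_prob0 (R : realType) (rate : R) k : 0 <= rate ->
  poisson_prob rate k [set 0%N] = (expR (- rate))%:E.
Proof.
rewrite le_eqVlt /poisson_prob => /predU1P[<-|rate0].
  by rewrite ltxx oppr0 expR0 diracE mem_set.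
rewrite rate0 esum_set1 ?lee_fin ?poisson_pmf_ge0//.
by rewrite /poisson_pmf rate0 expr0 fact0 invr1 !mul1r.
Qed.

(** Local finiteness is what makes this true: [npoints] also vanishes on an infinite
    intersection. *)
Lemma npoints_eq0 d (T : measurableType d) (R : realType) (P : probability T R)
    (Delta : R) (Phi : T -> set R) (A : set R) (w : T) :
  poisson_point_process P Delta Phi -> bounded_borel A ->
  (npoints Phi A w == 0%N) = `[< Phi w `&` A = set0 >].
Proof.
move=> ppp [mA [b Ab]].
have fA : finite_set (Phi w `&` A).
  by apply: sub_finite_set (ppp_locally_finite ppp w b); exact: setIS.
apply/idP/asboolP => [|H]; last by rewrite /npoints H fset_set0.
by rewrite /npoints cardfs_eq0 => /eqP/fset_set_set0; exact.
Qed.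

Lemma bounded_borel_itvoc (R : realType) (x y : R) : 0 <= x ->
  bounded_borel `]x, y]%classic.
Proof.
move=> x0; split; first exact: measurable_itv.
exists y => z /=; rewrite !in_itv/= => /andP[xz ->]; rewrite andbT.
exact: le_trans x0 (ltW xz).
Qed.

Section poisson_pattern.
Context d (T : measurableType d) (R : realType) (P : probability T R).
Variables (Delta : R) (Phi : T -> set R).
Hypotheses (Delta0 : 0 < Delta) (ppp : poisson_point_process P Delta Phi).

Definition hit_weight (l : R) (b : bool) : R :=
  if b then 1 - expR (- (Delta * l)) else expR (- (Delta * l)).

Lemma prob_hit (x y : R) (b : bool) : 0 <= x -> x <= y ->
  P [set w | (npoints Phi `]x, y]%classic w != 0%N) = b] =
    (hit_weight (y - x) b)%:E.
Proof.
move=> x0 xy.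
have bb : bounded_borel `]x, y]%classic by exact: bounded_borel_itvoc.
have mxy : fine (lebesgue_measure (`]x, y]%classic : set R)) = y - x.
  rewrite lebesgue_measure_itv/= lte_fin; case: ltP => //= yx.
  by rewrite (le_anti (_ : x <= y <= x)) ?subrr// xy yx.
have E : P (npoints Phi `]x, y]%classic @^-1` [set 0%N]) =
    (expR (- (Delta * (y - x))))%:E.
  rewrite (ppp_poisson ppp)// mxy poisson_prob0// mulr_ge0 ?subr_ge0//.
  exact: ltW.
case: b => /=; last first.
  rewrite -E; congr (P _); apply/seteqP.
  by split=> w /=; [move/negbFE/eqP|move=> ->].
rewrite EFinB -E -probability_setC; last first.
  by rewrite -[X in measurable X]setTI; apply: (ppp_measurable ppp).
congr (P _); apply/seteqP; split=> w /=; first by move/eqP.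
by move=> /eqP.
Qed.

(** Consecutive half-open cells are disjoint, so their counts are independent. An empty cell is
    allowed: its hit has weight 0. *)
Lemma prob_pattern_grid (n : nat) (g : nat -> R) (s : nat -> bool) :
  0 <= g 0%N -> {homo g : i j / (i <= j)%N >-> i <= j} ->
  P [set w | forall j, (j < n)%N ->
      (npoints Phi `]g j, g j.+1]%classic w != 0%N) = s j] =
  (\prod_(j < n) hit_weight (g j.+1 - g j) (s j))%:E.
Proof.
move=> g0 hg.
have gge0 j : 0 <= g j by apply: le_trans g0 (hg _ _ _).
pose A (i : 'I_n) : set R := `]g i, g i.+1]%classic.
have bA i : bounded_borel (A i) by exact: bounded_borel_itvoc.
have tA : trivIset [set: 'I_n] A.
  move=> i j _ _ [z []]; rewrite /A/= !in_itv/= => /andP[zi iz] /andP[zj jz].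
  apply: val_inj; apply/eqP; rewrite eqn_leq; apply/andP; split.
    rewrite leqNgt; apply/negP => /hg ji.
    have := lt_le_trans zi (le_trans jz ji).
    by rewrite ltxx.
  rewrite leqNgt; apply/negP => /hg ji; have := lt_le_trans zj (le_trans iz ji).
  by rewrite ltxx.
pose B (i : 'I_n) := [set k : nat | (k != 0%N) = s i].
have := @mutually_independent_seq _ _ _ P _ _ _ (fun i => npoints Phi (A i))
  (enum 'I_n) B (ppp_independent ppp bA tA) (enum_uniq _) (fun i _ => I).
rewrite big_enum/= => E.
transitivity
    (P [set w | forall i, i \in enum 'I_n -> B i (npoints Phi (A i) w)]).
  congr (P _); apply/seteqP; split=> w /= H.
    by move=> i _; exact: H.
  by move=> j jn; apply: (H (Ordinal jn)); rewrite mem_enum.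
rewrite E -prodEFin; apply: eq_bigr => i _.
by apply: prob_hit => //; exact: hg.
Qed.

End poisson_pattern.

Lemma measurable_forall_lt d (T : measurableType d) (n : nat)
    (Q : nat -> set T) : (forall j, (j < n)%N -> measurable (Q j)) ->
  measurable [set w | forall j, (j < n)%N -> Q j w].
Proof.
move=> mQ; rewrite (_ : [set w | _] = \bigcap_(j in `I_n) Q j) //.
by apply: fin_bigcap_measurable => // j; exact: mQ.
Qed.

(** * Mesh cells and the law of the rounded inter-arrival times *)

Section cells.
Variable R : realType.
Implicit Types (h x : R).

(** The ceiling makes the cells closed on the right, like the intervals between crawls; it is at
    least 1 for positive [x] and [h], so the predecessor loses nothing. *)
Definition cell_index h x : nat := `|Num.ceil (x / h)|%N.-1.

Lemma cell_indexP h x (k : nat) : 0 < h -> 0 < x ->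
  (cell_index h x == k) = (k%:R * h < x <= k.+1%:R * h).
Proof.
move=> h0 x0.
have xh0 : 0 < x / h by rewrite divr_gt0.
have c0 : (0 < Num.ceil (x / h))%R by rewrite ceil_gt0.
have -> : (cell_index h x == k) = (Num.ceil (x / h) == k.+1%:Z).
  rewrite /cell_index; move: c0; case: (Num.ceil _) => [m|//].
  by case: m => // m _ /=.
rewrite ceil_eq !ltr_pdivlMr// !ler_pdivrMr//.
by rewrite -addn1 PoszD addrK.
Qed.

(** A gap lying in cell [k i] is rounded up to the right end of that cell, hence the successor. *)
Definition grid_point h (k : nat -> nat) (j : nat) : R :=
  \sum_(i < j) (k i).+1%:R * h.

Lemma grid_pointS h k j :
  grid_point h k j.+1 = grid_point h k j + (k j).+1%:R * h.
Proof. by rewrite /grid_point big_ord_recr. Qed.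

Lemma eq_grid_point h k k' j : (forall i, (i < j)%N -> k i = k' i) ->
  grid_point h k j = grid_point h k' j.
Proof. by move=> kk'; apply: eq_bigr => i _; rewrite kk'. Qed.

Lemma grid_point_homo h k : 0 <= h ->
  {homo grid_point h k : i j / (i <= j)%N >-> i <= j}.
Proof.
move=> h0; apply: homo_leq => [//|y x z|j]; first exact: le_trans.
by rewrite grid_pointS lerDl mulr_ge0.
Qed.

End cells.

Section crawl_cells.
Context d (T : measurableType d) (R : realType) (P : probability T R).
Variables (p : R) (t : nat -> {RV P >-> R}).
Hypotheses (p0 : 0 < p) (crawl : crawl_times p t).

Definition gap (k : nat) (w : T) : R := t k.+1 w - t k w.

Lemma gap_gt0 k w : 0 < gap k w.
Proof. by rewrite subr_gt0; exact: crawl_increasing crawl _ _. Qed.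

Lemma measurable_gap k : measurable_fun [set: T] (gap k).
Proof. exact: measurable_funB. Qed.

(** Geometric law: the mass that the exponential law of rate [p] gives to cell [k]. *)
Definition cell_weight (h : R) (k : nat) : R :=
  (1 - expR (- (p * h))) * expR (- (p * h)) ^+ k.

Lemma prob_gap_le k (y : R) : 0 <= y ->
  P (gap k @^-1` `[0, y]) = (1 - expR (- (p * y)))%:E.
Proof.
rewrite le_eqVlt => /predU1P[<-|y0].
  rewrite mulr0 oppr0 expR0 subrr (_ : _ @^-1` _ = set0) ?measure0//.
  apply/seteqP; split=> w //=; rewrite in_itv/= => /andP[_].
  by rewrite leNgt gap_gt0.
rewrite (crawl_exponential crawl) ?exponential_prob_itv0c//.
by rewrite EFinB mulNr.
Qed.

Lemma prob_cell (h : R) i (k : nat) : 0 < h ->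
  P [set w | cell_index h (gap i w) = k] = (cell_weight h k)%:E.
Proof.
move=> h0.
have mg B : measurable B -> measurable (gap i @^-1` B).
  by move=> mB; rewrite -[X in measurable X]setTI; exact: measurable_gap.
have kh0 m : 0 <= m%:R * h by rewrite mulr_ge0// ltW.
have mc : measurable [set w | cell_index h (gap i w) = k].
  rewrite (_ : [set w | _] = gap i @^-1` `]k%:R * h, k.+1%:R * h]).
    exact: mg.
  apply/seteqP; split=> w /=; rewrite in_itv/= -cell_indexP ?gap_gt0//.
    by move/eqP.
  by move/eqP.
have E : P (gap i @^-1` `[0%R, k.+1%:R * h]) =
    (P (gap i @^-1` `[0%R, (k%:R * h)%R]) +
     P [set w | cell_index h (gap i w) = k])%E.
  rewrite (_ : gap i @^-1` `[0, k.+1%:R * h] = gap i @^-1` `[0, k%:R * h] `|`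
      [set w | cell_index h (gap i w) = k]); last first.
    apply/seteqP; split=> w /=; rewrite !in_itv/= (ltW (gap_gt0 _ _))/=.
      move=> gk; have [?|?] := leP (gap i w) (k%:R * h); [by left|right].
      by apply/eqP; rewrite cell_indexP ?gap_gt0//; apply/andP.
    move=> [gk|/eqP]; last by rewrite cell_indexP ?gap_gt0// => /andP[].
    by apply: le_trans gk _; rewrite ler_pM2r// ler_nat.
  apply: measureU => //; first exact: mg.
  apply/seteqP; split=> w //= []; rewrite in_itv/= => /andP[_ gk] /eqP.
  by rewrite cell_indexP ?gap_gt0// ltNge gk.
rewrite !prob_gap_le// in E.
have fP : P [set w | cell_index h (gap i w) = k] \is a fin_num.
  exact: fin_num_measure.
rewrite -(fineK fP) -EFinD in E; case: E => E; rewrite -(fineK fP); congr _%:E.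
have X m : expR (- (p * (m%:R * h))) = expR (- (p * h)) ^+ m.
  by rewrite -expRM_natl; congr expR; ring.
by rewrite /cell_weight; move: E; rewrite !X exprS; lra.
Qed.

Lemma prob_cells (h : R) (n : nat) (k : nat -> nat) : 0 < h ->
  P [set w | forall i, (i < n)%N -> cell_index h (gap i w) = k i] =
  (\prod_(i < n) cell_weight h (k i))%:E.
Proof.
move=> h0.
pose B (i : nat) : set R := `](k i)%:R * h, (k i).+1%:R * h]%classic.
have cellE i w : cell_index h (gap i w) = k i <-> B i (gap i w).
  by rewrite /B/= in_itv/= -cell_indexP ?gap_gt0//; split => /eqP.
have := @mutually_independent_seq _ _ _ P _ _ _ _ (iota 0 n) B
  (crawl_independent crawl) (iota_uniq _ _) (fun i _ => measurable_itv _).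
rewrite -(big_mkord xpredT (fun i => cell_weight h (k i))) -prodEFin => E.
transitivity (P [set w | forall i, i \in iota 0 n -> B i (gap i w)]).
  congr (P _); apply/seteqP; split=> w /= H i.
    by rewrite mem_iota/= add0n => /H/cellE.
  by move=> ni; apply/cellE/H; rewrite mem_iota.
rewrite E /index_iota subn0; apply: eq_bigr => i _.
rewrite -(prob_cell i)//; congr (P _); apply/seteqP.
by split=> w /= /cellE.
Qed.

End crawl_cells.

(** * Indicators of discretized crawl times *)

Lemma eseries_EFin (R : realType) (u : nat -> R) (l : R) :
  series u n @[n --> \oo] --> l ->
  (\sum_(0 <= i <oo) (u i)%:E = l%:E)%E.
Proof.
move=> ul; apply: cvg_lim => //.
rewrite (_ : (fun n => _) = EFin \o series u); last first.
  by apply/funext => n; rewrite /= sumEFin.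
by apply/fine_cvgP; split; [exact: nearW|exact: ul].
Qed.

Lemma preimage_sigma_generated d (T : measurableType d) (I : Type) (D : set I)
    d' (T' : measurableType d') (X : I -> T -> T') i (B : set T') :
  D i -> measurable B -> sigma_generated D X (X i @^-1` B).
Proof.
move=> Di mB; apply: sub_gen_smallest; exists i => //.
by exists B => //; rewrite setTI.
Qed.

Section model.
Context d (T : measurableType d) (R : realType) (P : probability T R).
Variables (Delta p : R) (Phi : T -> set R) (t : nat -> {RV P >-> R}).
Hypotheses (Delta0 : 0 < Delta) (p0 : 0 < p).
Hypothesis model : page_crawl_model Delta p Phi t.
Let ppp := model_changes model.
Let crawl := model_crawls model.

Definition grid_hit (g : nat -> R) (j : nat) (w : T) : bool :=
  npoints Phi `]g j, g j.+1]%classic w != 0%N.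

Definition cell_grid (h : R) (w : T) : nat -> R :=
  grid_point h (fun i => cell_index h (gap t i w)).

Definition cell_event (h : R) (n : nat) (k : nat -> nat) : set T :=
  [set w | forall i, (i < n)%N -> cell_index h (gap t i w) = k i].

Definition hit_event (g : nat -> R) (n : nat) (s : nat -> bool) : set T :=
  [set w | forall j, (j < n)%N -> grid_hit g j w = s j].

(** Taking the sigma-algebra generated by the crawl times as the measurable structure on [T] turns
    an ordinary measurability proof into the membership that [model_independent] requires. *)
Lemma sigma_cell_event h n k : 0 < h ->
  sigma_generated [set: nat] (fun k => t k : T -> R) (cell_event h n k).
Proof.
move=> h0.
pose G := \bigcup_(i in [set: nat])
  preimage_set_system [set: T] (t i : T -> R) measurable.
apply: (@measurable_forall_lt _ (g_sigma_algebraType G) n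
  (fun i w => cell_index h (gap t i w) = k i)) => i _.
have mt j : measurable_fun [set: g_sigma_algebraType G] (t j : T -> R).
  move=> _ B mB; rewrite setTI.
  exact: (@preimage_sigma_generated _ T _ _ _ _ (fun k => t k : T -> R)).
have mg : measurable_fun [set: g_sigma_algebraType G]
    ((t i.+1 : T -> R) \- (t i : T -> R)).
  exact: measurable_funB.
rewrite (_ : (fun w => _) = gap t i @^-1` `](k i)%:R * h, (k i).+1%:R * h]).
  by rewrite -[X in measurable X]setTI; exact: mg.
apply/seteqP; split=> w /=; rewrite in_itv/= -cell_indexP ?(gap_gt0 crawl)//.
  by move/eqP.
by move/eqP.
Qed.

Lemma sigma_hit_event (g : nat -> R) n s : (forall j, 0 <= g j) ->
  sigma_generated (@bounded_borel R) (npoints Phi) (hit_event g n s).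
Proof.
move=> g0.
pose G := \bigcup_(A in @bounded_borel R)
  preimage_set_system [set: T] (npoints Phi A) measurable.
apply: (@measurable_forall_lt _ (g_sigma_algebraType G) n
  (fun j w => grid_hit g j w = s j)) => j _.
apply: (@preimage_sigma_generated _ T _ (@bounded_borel R) _ _ (npoints Phi)
  `]g j, g j.+1]%classic [set m | (m != 0%N) = s j]) => //.
exact: bounded_borel_itvoc.
Qed.

Lemma measurable_hit_event (g : nat -> R) n s : (forall j, 0 <= g j) ->
  measurable (hit_event g n s).
Proof.
move=> g0.
apply: (@measurable_forall_lt _ _ n (fun j w => grid_hit g j w = s j)) => j _.
change (measurable (npoints Phi `]g j, g j.+1]%classic @^-1`
  [set m | (m != 0%N) = s j])).
rewrite -[X in measurable X]setTI; apply: (ppp_measurable ppp) => //.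
exact: bounded_borel_itvoc.
Qed.

Lemma measurable_cell_event h n k : 0 < h -> measurable (cell_event h n k).
Proof.
move=> h0; apply: (@measurable_forall_lt _ _ n
  (fun i w => cell_index h (gap t i w) = k i)) => i _.
rewrite (_ : (fun w => _) = gap t i @^-1` `](k i)%:R * h, (k i).+1%:R * h]).
  by rewrite -[X in measurable X]setTI; exact: measurable_gap.
apply/seteqP; split=> w /=; rewrite in_itv/= -cell_indexP ?(gap_gt0 crawl)//.
  by move/eqP.
by move/eqP.
Qed.

Definition cell_hit_weight (h : R) (b : bool) (l : nat) : R :=
  cell_weight p h l * hit_weight Delta (l.+1%:R * h) b.

(** The hit pattern is read on the random rounded grid for all [n] intervals, while only [m] cells
    are prescribed: [m = n] freezes the grid, [m = 0] leaves the event of interest. *)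
Definition partial_event (h : R) (n : nat) (s : nat -> bool)
    (m : nat) (k : nat -> nat) : set T :=
  cell_event h m k `&`
  [set w | forall j, (j < n)%N -> grid_hit (cell_grid h w) j w = s j].

Lemma partial_event_full h n s k :
  partial_event h n s n k = hit_event (grid_point h k) n s `&` cell_event h n k.
Proof.
have E w j : cell_event h n k w -> (j < n)%N ->
    grid_hit (cell_grid h w) j w = grid_hit (grid_point h k) j w.
  move=> cw jn; rewrite /grid_hit /cell_grid.
  by rewrite !(@eq_grid_point _ h _ k)// => i ij; apply: cw;
    apply: leq_trans ij _ => //; exact: ltnW.
rewrite setIC; apply/seteqP; split=> w /= [cw H]; split=> // j jn.
  by rewrite -E// H.
by rewrite E// H.
Qed.

(** With all cells prescribed the grid is deterministic, so the event splits into one about the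
    changes and one about the crawls, which are independent. *)
Lemma prob_partial_event_full h n s k : 0 < h ->
  measurable (partial_event h n s n k) /\
  P (partial_event h n s n k) =
    (\prod_(j < n) cell_hit_weight h (s j) (k j))%:E.
Proof.
move=> h0; rewrite partial_event_full.
have hg := grid_point_homo k (ltW h0).
have g00 : 0 <= grid_point h k 0 by rewrite /grid_point big_ord0.
have g0 j : 0 <= grid_point h k j by apply: le_trans g00 (hg _ _ _).
split.
  apply: measurableI; first exact: measurable_hit_event.
  exact: measurable_cell_event.
rewrite (model_independent model); first last.
- exact: sigma_cell_event.
- exact: sigma_hit_event.
rewrite (prob_pattern_grid Delta0 ppp)// (prob_cells crawl)//.
rewrite -EFinM -big_split/=.
congr _%:E; apply: eq_bigr => j _; by rewrite grid_pointS addrC addKr mulrC.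
Qed.

(* Downward induction on the number of prescribed cells: summing over the last
   one replaces its weight by the sum [c] of all weights. *)
Lemma prob_partial_event (c : bool -> R) h n s : 0 < h ->
  (forall b, \sum_(0 <= l <oo) (cell_hit_weight h b l)%:E = (c b)%:E)%E ->
  (forall b l, 0 <= cell_hit_weight h b l) ->
  forall m, (m <= n)%N -> forall k,
  measurable (partial_event h n s (n - m) k) /\
  P (partial_event h n s (n - m) k) =
    (\prod_(j < n - m) cell_hit_weight h (s j) (k j) *
     \prod_(n - m <= j < n) c (s j))%:E.
Proof.
move=> h0 sumc u0; elim=> [_ k|m IH mn k].
  by rewrite subn0 big_geq// mulr1; exact: prob_partial_event_full.
have := IH (ltnW mn); rewrite (_ : n - m = (n - m.+1).+1)%N; last first.
  by rewrite subnSK.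
set q := (n - m.+1)%N => {}IH.
have qn : (q < n)%N by rewrite /q ltn_subrL (leq_ltn_trans (leq0n m) mn).
pose k' l i := if i == q then l else k i.
have partE :
    partial_event h n s q k = \bigcup_l partial_event h n s q.+1 (k' l).
  apply/seteqP; split=> w /=.
    move=> [cw sw]; exists (cell_index h (gap t q w)) => //; split => // i.
    rewrite ltnS leq_eqVlt /k' => /predU1P[->|iq]; first by rewrite eqxx.
    by rewrite ltn_eqF// cw.
  move=> [l _ [cw sw]]; split => // i iq.
  by rewrite cw ?ltnS 1?ltnW// /k' ltn_eqF.
have mp l := (IH (k' l)).1.
split; first by rewrite partE; exact: bigcup_measurable.
rewrite partE measure_semi_bigcup//; first last.
- exact: bigcup_measurable.
- move=> l1 l2 _ _ [w [[c1 _] [c2 _]]].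
  by have := c1 q (ltnSn _); rewrite (c2 q (ltnSn _)) /k' eqxx.
transitivity (\sum_(0 <= l <oo)
    ((\prod_(j < q) cell_hit_weight h (s j) (k j) *
     \prod_(q.+1 <= j < n) c (s j))%:E * (cell_hit_weight h (s q) l)%:E))%E.
  apply: eq_eseriesr => l _.
  apply: etrans (IH (k' l)).2 _; rewrite -EFinM; congr _%:E.
  rewrite big_ord_recr/= {2}/k' eqxx mulrAC; congr (_ * _ * _).
  by apply: eq_bigr => j _; rewrite /k' ltn_eqF.
rewrite nneseriesZl; last by move=> l _; rewrite lee_fin.
by rewrite sumc -EFinM (big_ltn qn) mulrAC mulrA.
Qed.

End model.

(** * Vanishing mesh *)

(** The indicator functions converge pointwise and are bounded by 1, so dominated convergence
    applies. Measurability of [B] is part of the conclusion because it is not known beforehand for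
    the true hit events. *)
Lemma eventually_eq_measure d (T : measurableType d) (R : realType)
    (P : probability T R) (A : nat -> set T) (B : set T) :
  (forall m, measurable (A m)) ->
  (forall w, \forall m \near \oo, A m w <-> B w) ->
  measurable B /\ P (A m) @[m --> \oo] --> P B.
Proof.
move=> mA AB.
have mB : measurable B.
  (* Eventual agreement at each point makes [B] the lower limit of the [A m]. *)
  rewrite (_ : B = \bigcup_M \bigcap_(m in [set m | (M <= m)%N]) A m).
    apply: bigcup_measurable => M _; apply: bigcap_measurable => //.
    by exists M => /=.
  apply/seteqP; split=> w.
    move=> Bw; have [M _ HM] := AB w.
    by exists M => // m /= Mm; apply/(HM m Mm).
  move=> [M _ HM]; have [N _ HN] := AB w.
  apply/(HN (maxn M N)); first by rewrite /= leq_maxr.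
  by apply: HM; rewrite /= leq_maxl.
split=> //.
have := @dominated_convergence _ _ _ P setT measurableT
  (fun m w => (\1_(A m) w)%:E) (fun w => (\1_B w)%:E) (cst 1%E).
case=> //.
- by move=> m; apply/measurable_EFinP; exact: measurable_indic.
- by apply/measurable_EFinP; exact: measurable_indic.
- apply: aeW => w _; apply: cvg_near_cst.
  apply: filterS (AB w) => m ABm; congr _%:E; rewrite !indicE; congr (_%:R).
  by congr nat_of_bool; apply/idP/idP => /set_mem H; apply/mem_set/ABm.
- by apply: finite_measure_integrable_cst.
- apply: aeW => w m _; rewrite /= lee_fin indicE.
  by case: (_ \in _); rewrite ?normr1 ?normr0.
move=> _ _.
rewrite integral_indic// setIT.
rewrite (_ : (fun x => _) = fun m => P (A m))//.
by apply/funext => m; rewrite integral_indic// setIT.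
Qed.

(** Used with [F] the changes in a bounded window: moving a crawl time to the right by at most [e]
    passes over no change. *)
Lemma finite_set_right_gap (R : realType) (F : set R) (x : R) :
  finite_set F ->
  exists2 e : R, 0 < e & forall y, F y -> x < y -> x + e < y.
Proof.
move=> /finite_seqP[s ->]; elim: s => [|a s [e e0 IH]].
  by exists 1 => // y.
have [ax|xa] := leP a x.
  exists e => // y /=; rewrite inE => /predU1P[->|]; last exact: IH.
  by rewrite ltNge ax.
exists (Num.min e ((a - x) / 2)).
  by rewrite lt_min e0 divr_gt0// subr_gt0.
move=> y /=; rewrite inE => /predU1P[->|ys] xy.
  apply: le_lt_trans (_ : x + (a - x) / 2 < a); last by lra.
  by rewrite lerD2l ge_min lexx orbT.
by apply: le_lt_trans (IH _ ys xy); rewrite lerD2l ge_min lexx.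
Qed.

(** * The geometric series for the rounded indicators and its limit *)

Section series.
Variables (R : realType) (Delta p : R).
Hypotheses (Delta0 : 0 < Delta) (p0 : 0 < p).

(** With [A = expR (- (p * h))] and [B = expR (- (Delta * h))], the value [r] is the sum of the
    geometric series with first term [(1 - A) * B] and ratio [A * B]. *)
Definition grid_prob (h : R) (b : bool) : R :=
  let r := (1 - expR (- (p * h))) * expR (- (Delta * h)) /
           (1 - expR (- (p * h)) * expR (- (Delta * h))) in
  if b then 1 - r else r.

Lemma expR_lt1_neg (x : R) : 0 < x -> expR (- x) < 1.
Proof. by move=> x0; rewrite -expR0 ltr_expR oppr_lt0. Qed.

Lemma cell_hit_weight_ge0 h b l : 0 < h -> 0 <= cell_hit_weight Delta p h b l.
Proof.
move=> h0; rewrite mulr_ge0//.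
  rewrite mulr_ge0 ?exprn_ge0 ?expR_ge0// subr_ge0 ltW//.
  by rewrite expR_lt1_neg ?mulr_gt0.
case: b; rewrite /hit_weight ?expR_ge0// subr_ge0 ltW// expR_lt1_neg//.
by rewrite !mulr_gt0// ltr0n.
Qed.

Lemma cell_hit_weight_sum h b : 0 < h ->
  (\sum_(0 <= l <oo) (cell_hit_weight Delta p h b l)%:E = (grid_prob h b)%:E)%E.
Proof.
move=> h0; apply: eseries_EFin.
set A := expR (- (p * h)); set B := expR (- (Delta * h)).
have A0 : 0 < A by exact: expR_gt0.
have B0 : 0 < B by exact: expR_gt0.
have A1 : A < 1 by rewrite expR_lt1_neg// mulr_gt0.
have B1 : B < 1 by rewrite expR_lt1_neg// mulr_gt0.
have AB1 : A * B < 1 by nra.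
have BE l : expR (- (Delta * (l.+1%:R * h))) = B * B ^+ l.
  by rewrite -exprS -expRM_natl; congr expR; ring.
have cf : series (cell_hit_weight Delta p h false) n @[n --> \oo]
    --> grid_prob h false.
  rewrite (_ : cell_hit_weight _ _ _ _ = geometric ((1 - A) * B) (A * B)).
    by apply: cvg_geometric_series; rewrite ger0_norm// mulr_ge0// ltW.
  apply/funext => l; rewrite /cell_hit_weight /cell_weight /hit_weight BE.
  by rewrite /geometric/= exprMn -/A; ring.
case: b => //.
(* The hit case is the total cell mass, a geometric series of sum 1, minus the case without a
   hit. *)
rewrite (_ : cell_hit_weight _ _ _ _ = geometric (1 - A) A \-
    cell_hit_weight Delta p h false); last first.
  apply/funext => l.
  by rewrite /= /cell_hit_weight /cell_weight /hit_weight BE -/A; ring.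
rewrite (_ : series _ = series (geometric (1 - A) A) \-
    series (cell_hit_weight Delta p h false)); last first.
  by apply/funext => n; rewrite /series/= sumrB.
apply: cvgB => //.
have {2}-> : 1 = (1 - A) / (1 - A) by rewrite divff// subr_eq0 gt_eqF.
by apply: cvg_geometric_series; rewrite ger0_norm// ltW.
Qed.

Definition hit_prob (b : bool) : R :=
  if b then Delta / (Delta + p) else p / (Delta + p).

(** All estimates come from [1 + z <= expR z], applied to both signs. At [x = p * h] and
    [y = Delta * h] the two bounds tend to [p / (Delta + p)] with [h]. *)
Lemma exp_ratio_bounds (x y : R) : 0 < x -> 0 < y ->
  x / (1 + x) * (1 - y) / (x + y) <=
  (1 - expR (- x)) * expR (- y) / (1 - expR (- x) * expR (- y)) <=
  x * (1 + (x + y)) / (x + y).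
Proof.
move=> x0 y0; rewrite -expRD -opprD.
have xy0 : 0 < x + y by rewrite addr_gt0.
have expN_le (z : R) : 0 < z -> expR (- z) <= (1 + z)^-1.
  move=> z0; have z1 : 0 < 1 + z by rewrite addr_gt0.
  by rewrite expRN lef_pV2 ?posrE ?expR_gt0// expR_ge1Dx.
have A1 : x / (1 + x) <= 1 - expR (- x).
  have := expN_le _ x0; suff -> : x / (1 + x) = 1 - (1 + x)^-1 by lra.
  by field; rewrite gt_eqF// addr_gt0.
have AB1 : (x + y) / (1 + (x + y)) <= 1 - expR (- (x + y)).
  have := expN_le _ xy0.
  suff -> : (x + y) / (1 + (x + y)) = 1 - (1 + (x + y))^-1 by lra.
  by field; rewrite gt_eqF// addr_gt0.
have A2 : 1 - expR (- x) <= x by have := expR_ge1Dx (- x); lra.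
have AB2 : 1 - expR (- (x + y)) <= x + y.
  by have := expR_ge1Dx (- (x + y)); lra.
have B2 : 1 - y <= expR (- y) by have := expR_ge1Dx (- y); lra.
have B1 : expR (- y) < 1 by exact: expR_lt1_neg.
have AB3 : 0 < 1 - expR (- (x + y)) by rewrite subr_gt0 expR_lt1_neg.
have A3 : 0 < 1 - expR (- x) by rewrite subr_gt0 expR_lt1_neg.
have B0 : 0 < expR (- y) by exact: expR_gt0.
have x1 : 0 < x / (1 + x) by rewrite divr_gt0// addr_gt0.
apply/andP; split.
  apply: (@le_trans _ _ ((1 - expR (- x)) * expR (- y) / (x + y))).
    rewrite ler_pM2r ?invr_gt0//.
    by apply: (@le_trans _ _ (x / (1 + x) * expR (- y)));
      [rewrite ler_pM2l|rewrite ler_pM2r].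
  by rewrite ler_pM2l ?mulr_gt0// lef_pV2.
apply: (@le_trans _ _ (x / (1 - expR (- (x + y))))).
  rewrite ler_pM2r ?invr_gt0//.
  by rewrite -[leRHS]mulr1; apply: ler_pM => //; exact: ltW.
rewrite -mulrA ler_pM2l// -[leRHS]invrK lef_pV2 ?posrE//.
  by rewrite invf_div.
by rewrite invr_gt0 divr_gt0// addr_gt0.
Qed.

Lemma grid_prob_cvg b : grid_prob (m.+1%:R^-1) b @[m --> \oo] --> hit_prob b.
Proof.
have D0 : Delta + p != 0 by rewrite gt_eqF// addr_gt0.
have hC (c : R) : c * m.+1%:R^-1 @[m --> \oo] --> 0.
  rewrite -[X in _ --> X](mulr0 c).
  by apply: cvgM; [exact: cvg_cst|exact: cvg_harmonic].
have cf : grid_prob (m.+1%:R^-1) false @[m --> \oo] --> hit_prob false.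
  (* [lo] and [hi] are the two bounds after cancelling [h], so that their limits are no longer of
     the form 0/0. *)
  pose lo (h : R) := p / (1 + p * h) * (1 - Delta * h) / (Delta + p).
  pose hi (h : R) := p * (1 + (Delta + p) * h) / (Delta + p).
  apply: (@squeeze_cvgr _ _ _ _ (fun m => lo m.+1%:R^-1)
    (fun m => hi m.+1%:R^-1)).
  - apply: nearW => m; set h : R := m.+1%:R^-1.
    have h0 : 0 < h by rewrite invr_gt0.
    have ph : 0 < 1 + p * h by rewrite addr_gt0 ?mulr_gt0.
    have := exp_ratio_bounds (mulr_gt0 p0 h0) (mulr_gt0 Delta0 h0).
    rewrite -[X in _ <= X <= _]/(grid_prob h false).
    have Dh : p * h + Delta * h != 0.
      by rewrite gt_eqF// -mulrDl mulr_gt0 ?addr_gt0.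
    have -> : p * h / (1 + p * h) * (1 - Delta * h) / (p * h + Delta * h) =
        lo h.
      by rewrite /lo; field; rewrite D0 Dh gt_eqF.
    have -> : p * h * (1 + (p * h + Delta * h)) / (p * h + Delta * h) = hi h.
      by rewrite /hi; field; rewrite D0 Dh.
    by [].
  - rewrite (_ : hit_prob _ = p / (1 + 0) * (1 - 0) / (Delta + p)); last first.
      by rewrite /hit_prob; field.
    apply: cvgM; last exact: cvg_cst.
    apply: cvgM; last by apply: cvgB; [exact: cvg_cst|exact: hC].
    apply: cvgM; first exact: cvg_cst.
    apply: cvgV; first by rewrite addr0 oner_eq0.
    by apply: cvgD; [exact: cvg_cst|exact: hC].
  - rewrite (_ : hit_prob _ = p * (1 + 0) / (Delta + p)); last first.
      by rewrite /hit_prob; field.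
    apply: cvgM; last exact: cvg_cst.
    apply: cvgM; first exact: cvg_cst.
    by apply: cvgD; [exact: cvg_cst|exact: hC].
case: b => //.
rewrite /hit_prob (_ : Delta / (Delta + p) = 1 - p / (Delta + p)); last first.
  by field.
by apply: cvgB cf; exact: cvg_cst.
Qed.

End series.

(** * Joint law of the true change indicators *)

Section hits.
Context d (T : measurableType d) (R : realType) (P : probability T R).
Variables (Delta p : R) (Phi : T -> set R) (t : nat -> {RV P >-> R}).
Hypotheses (Delta0 : 0 < Delta) (p0 : 0 < p).
Hypothesis model : page_crawl_model Delta p Phi t.
Let ppp := model_changes model.
Let crawl := model_crawls model.

(** Rounding lengthens each gap by less than [h], and the errors add up. *)
Lemma cell_grid_bounds h w j : 0 < h ->
  t j w <= cell_grid t h w j <= t j w + j%:R * h.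
Proof.
move=> h0; elim: j => [|j /andP[IH1 IH2]].
  rewrite (crawl_start crawl) /cell_grid /grid_point big_ord0 mul0r addr0.
  by rewrite lexx.
have := eqxx (cell_index h (gap t j w)).
rewrite cell_indexP ?(gap_gt0 crawl)// => /andP[].
rewrite /cell_grid grid_pointS -/(cell_grid t h w j).
set g := cell_grid t h w j in IH1 IH2 *.
rewrite /gap -(natr1 (cell_index _ _)) -(natr1 j) !mulrDl !mul1r => H1 H2.
by apply/andP; split; lra.
Qed.

Lemma crawl_ge0 j w : 0 <= t j w.
Proof.
elim: j => [|j IH]; first by rewrite (crawl_start crawl).
exact: le_trans IH (ltW (crawl_increasing crawl _ _)).
Qed.

Definition hit (j : nat) (w : T) : bool :=
  `[< Phi w `&` `]t j w, t j.+1 w] !=set0 >].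

(** For a fine mesh, both ends of the interval move to the right by less than the distance to the
    next change, so no change enters or leaves it. *)
Lemma grid_hit_eventually w j :
  \forall m \near \oo, grid_hit Phi (cell_grid t m.+1%:R^-1 w) j w = hit j w.
Proof.
(* Since [h <= 1], the rounded time is at most [t j.+1 w + j.+1]; thus a change beyond [b] lies in
   neither interval. *)
pose b := t j.+1 w + j.+1%:R + 1.
have fF : finite_set (Phi w `&` `[0, b]) by exact: ppp_locally_finite ppp w b.
have [e1 e10 He1] := finite_set_right_gap (t j w) fF.
have [e2 e20 He2] := finite_set_right_gap (t j.+1 w) fF.
pose e := Num.min e1 e2.
have e0 : 0 < e by rewrite lt_min e10.
have cv : j.+1%:R * m.+1%:R^-1 @[m --> \oo] --> (0 : R).
  rewrite -[X in _ --> X](mulr0 j.+1%:R).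
  by apply: cvgM; [exact: cvg_cst|exact: cvg_harmonic].
have nb : \forall m \near \oo, j.+1%:R * m.+1%:R^-1 < e.
  by apply: cvgr_lt e0; exact: cv.
apply: filterS nb => m; set h : R := m.+1%:R^-1 => jh.
have h0 : 0 < h by rewrite invr_gt0.
have h1 : h <= 1 by rewrite invf_le1// ler1n.
have /andP[a1 a2] := cell_grid_bounds w j h0.
have /andP[b1 b2] := cell_grid_bounds w j.+1 h0.
have jh2 : j%:R * h <= j.+1%:R * h by rewrite ler_pM2r// ler_nat.
have jh1 : j.+1%:R * h <= j.+1%:R by rewrite ler_piMr.
have [ee1 ee2] : e <= e1 /\ e <= e2 by rewrite !ge_min !lexx orbT.
have tj := crawl_increasing crawl j w.
have lt_iff y : Phi w y ->
    (y \in `]cell_grid t h w j, cell_grid t h w j.+1]) =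
    (y \in `]t j w, t j.+1 w]).
  move=> Py; rewrite !in_itv/=; have [yb|by_] := leP y b; last first.
    rewrite [X in _ && X]leNgt [X in _ = _ && X]leNgt /b in by_ *.
    have -> : t j.+1 w < y by have : (0 : R) <= j.+1%:R by []; lra.
    have -> : cell_grid t h w j.+1 < y by lra.
    by rewrite !andbF.
  have yF : 0 <= y -> (Phi w `&` `[0, b]) y.
    by move=> y0; split => //=; rewrite in_itv/= y0.
  have y0 : 0 <= y.
    by have /= := ppp_nonneg ppp Py; rewrite in_itv/= andbT.
  have H1 := He1 _ (yF y0); have H2 := He2 _ (yF y0).
  congr (_ && _).
    by apply/idP/idP => [|ty]; [|have := H1 ty]; lra.
  rewrite !leNgt; congr (~~ _).
  by apply/idP/idP => [|ty]; [|have := H2 ty]; lra.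
have g0 : 0 <= cell_grid t h w j by apply: le_trans a1; exact: crawl_ge0.
rewrite /grid_hit (npoints_eq0 _ ppp); last exact: bounded_borel_itvoc.
rewrite /hit; apply/idP/idP.
  move=> /asboolPn/eqP/set0P[y [Py yc]].
  by apply/asboolP; exists y; split => //=; rewrite -lt_iff.
move=> /asboolP[y [Py yc]].
by apply/asboolPn/eqP/set0P; exists y; split => //=; rewrite lt_iff.
Qed.

(** Passes to the limit along the meshes [1 / (m + 1)]. The product form, valid for every pattern,
    says that the indicators are iid Bernoulli. *)
Lemma prob_hits (n : nat) (s : nat -> bool) :
  measurable [set w | forall j, (j < n)%N -> hit j w = s j] /\
  P [set w | forall j, (j < n)%N -> hit j w = s j] =
    (\prod_(j < n) hit_prob Delta p (s j))%:E.
Proof.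
pose h (m : nat) : R := m.+1%:R^-1.
have h0 m : 0 < h m by rewrite invr_gt0.
(* With zero prescribed cells this is the whole event for the rounded times; [fun=> 0%N] is a
   placeholder. *)
pose A m := partial_event Phi t (h m) n s 0 (fun=> 0%N).
have AP m : measurable (A m) /\
    P (A m) = (\prod_(j < n) grid_prob Delta p (h m) (s j))%:E.
  have := @prob_partial_event _ _ _ _ _ _ _ _ Delta0 model
    (grid_prob Delta p (h m)) _ n s (h0 m)
    (fun b => cell_hit_weight_sum Delta0 p0 b (h0 m))
    (fun b l => cell_hit_weight_ge0 Delta0 p0 b l (h0 m))
    n (leqnn n) (fun=> 0%N).
  by rewrite subnn big_ord0 mul1r big_mkord.
have AB w : \forall m \near \oo,
    A m w <-> [set w | forall j, (j < n)%N -> hit j w = s j] w.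
  suff : \forall m \near \oo, forall j, (j < n)%N ->
      grid_hit Phi (cell_grid t (h m) w) j w = hit j w.
    apply: filterS => m Hm; split => [[_ H] j jn|H]; first by rewrite -Hm// H.
    by split => // j jn; rewrite Hm// H.
  elim: n {A AP} => [|k IH]; first by apply: nearW => m j.
  have Hk := grid_hit_eventually w k.
  apply: filterS2 IH Hk => m Hm Hk j.
  by rewrite ltnS leq_eqVlt => /predU1P[->//|]; exact: Hm.
have [mB cvB] := eventually_eq_measure P (fun m => (AP m).1) AB.
split => //; move: cvB.
rewrite [X in X @ _ --> _ -> _](_ : _ =
    (fun m => (\prod_(j < n) grid_prob Delta p (h m) (s j))%:E)); last first.
  by apply/funext => m; exact: (AP m).2.
move=> cvB; apply: (cvg_unique (@ereal_hausdorff R) cvB).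
apply/fine_cvgP; split; first exact: nearW.
elim: n {A AP AB mB cvB} => [|n IH].
  by under eq_fun do rewrite big_ord0; rewrite big_ord0; exact: cvg_cst.
under eq_fun do rewrite big_ord_recr; rewrite big_ord_recr/=.
by apply: cvgM => //; exact: grid_prob_cvg.
Qed.

End hits.

(** * Finite sequences of coin flips *)

Section coin_flips.
Variables (R : realType) (q : R).
Implicit Types (F G : seq bool -> R).

(** Expectation of [F] over [n] independent flips of bias [q], written as a finite recursion so that
    moment estimates become plain algebra. *)
Fixpoint flipE (n : nat) (F : seq bool -> R) : R :=
  if n is n'.+1 then
    q * flipE n' (fun s => F (true :: s)) +
    (1 - q) * flipE n' (fun s => F (false :: s))
  else F [::].

Lemma eq_flipE n F G : F =1 G -> flipE n F = flipE n G.
Proof. by move=> /funext ->. Qed.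

(** [flipE] conditions on the first flip, whereas one step of the estimator calls for conditioning
    on the last. *)
Lemma flipE_rcons n F : flipE n.+1 F =
  flipE n (fun s => q * F (rcons s true) + (1 - q) * F (rcons s false)).
Proof.
elim: n F => [//|n IH] F.
rewrite -[LHS]/(q * flipE n.+1 (fun s => F (true :: s)) +
  (1 - q) * flipE n.+1 (fun s => F (false :: s))).
rewrite [RHS]/=; congr (_ * _ + _ * _); exact: IH.
Qed.

Lemma flipE_drop m n F : flipE (m + n) (fun s => F (drop m s)) = flipE n F.
Proof.
elim: m => [|m IH] /=; first by apply: eq_flipE => s; rewrite drop0.
by rewrite -mulrDl addrC subrK mul1r.
Qed.

Lemma flipE_lin n (a b : R) F G :
  flipE n (fun s => a * F s + b * G s) = a * flipE n F + b * flipE n G.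
Proof. by elim: n F G => [//|n IH] F G /=; rewrite !IH; ring. Qed.

Lemma flipE_cst n (c : R) : flipE n (fun=> c) = c.
Proof. by elim: n => [//|n IH] /=; rewrite IH; ring. Qed.

Hypothesis q01 : 0 <= q <= 1.

Lemma le_flipE n F G : (forall s, size s = n -> F s <= G s) ->
  flipE n F <= flipE n G.
Proof.
move: q01 => /andP[q0 q1].
elim: n F G => [|n IH] F G FG /=; first exact: FG.
rewrite lerD// ler_wpM2l ?subr_ge0// IH// => s sn; apply: FG; by rewrite /= sn.
Qed.

(** Tells whether the walk started at [x], with centred steps [eta i * (b - q)], ever reaches
    modulus [eps], time 0 included. *)
Fixpoint exceeds (eps x : R) (eta : nat -> R) (s : seq bool) : bool :=
  (eps <= `|x|) ||
  if s is b :: s' then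
    exceeds eps (x + eta 0%N * (b%:R - q)) (fun i => eta i.+1) s'
  else false.

(* Kolmogorov's maximal inequality, by conditioning on the first flip: the bound
   is at least 1 when [eps <= `|x|], and otherwise its average over the first
   step of the walk is the bound itself. *)
Lemma flipE_exceeds n (eps x : R) (eta : nat -> R) : 0 < eps ->
  flipE n (fun s => (exceeds eps x eta s)%:R) <=
  (x ^+ 2 + q * (1 - q) * \sum_(i < n) eta i ^+ 2) / eps ^+ 2.
Proof.
move=> e0; move: (q01) => /andP[q0 q1].
have qq : 0 <= q * (1 - q) by rewrite mulr_ge0 ?subr_ge0.
have e2 : 0 < eps ^+ 2 by rewrite exprn_gt0.
elim: n x eta => [|n IH] x eta.
  rewrite big_ord0 mulr0 addr0 /= orbF; have [ex|_] := leP eps `|x|; last first.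
    by rewrite divr_ge0 ?sqr_ge0// ltW.
  rewrite ler_pdivlMr// mul1r -[leRHS]real_normK ?num_real//.
  by rewrite lerXn2r ?nnegrE// ltW.
have [ex|ex] := leP eps `|x|.
  apply: (@le_trans _ _ (flipE n.+1 (fun=> 1))).
    by apply: le_flipE => s _; case: (exceeds _ _ _ _).
  rewrite flipE_cst ler_pdivlMr// mul1r -[leLHS]addr0 lerD//.
    rewrite -[leRHS]real_normK ?num_real//.
    by rewrite lerXn2r ?nnegrE// ltW.
  by rewrite mulr_ge0// sumr_ge0// => i _; exact: sqr_ge0.
have H b := IH (x + eta 0%N * ((b : bool)%:R - q)) (fun i => eta i.+1).
rewrite [leLHS]/= (leNgt eps) ex/=.
apply: le_trans (lerD (ler_wpM2l q0 (H true)) (ler_wpM2l _ (H false))) _.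
  by rewrite subr_ge0.
rewrite big_ord_recl/= (eq_bigr (fun i : 'I_n => eta i.+1 ^+ 2))//.
set S := \sum_(i < n) _.
(* The cross terms cancel because the step has mean 0; its variance is
   [q * (1 - q) * eta 0 ^+ 2]. *)
rewrite le_eqVlt; apply/orP; left; apply/eqP.
by field; rewrite gt_eqF.
Qed.

Lemma exceedsP n (eps x : R) (eta : nat -> R) (f : nat -> bool) :
  reflect (exists2 k, (k <= n)%N &
      eps <= `|x + \sum_(i < k) eta i * ((f i)%:R - q)|)
    (exceeds eps x eta (mkseq f n)).
Proof.
elim: n x eta f => [|n IH] x eta f.
  rewrite /= orbF; apply: (iffP idP) => [ex|[[|//] _]].
    by exists 0%N => //; rewrite big_ord0 addr0.
  by rewrite big_ord0 addr0.
have -> : mkseq f n.+1 = f 0%N :: mkseq (fun i => f i.+1) n.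
  by rewrite /mkseq -[iota 0 n.+1]/(0%N :: iota 1 n) /= (iotaDl 1 0) -map_comp.
apply: (iffP orP) => [[ex|/IH[k kn ek]]|[[|k] kn ek]].
- by exists 0%N => //; rewrite big_ord0 addr0.
- by exists k.+1 => //; rewrite big_ord_recl addrA.
- by left; rewrite big_ord0 addr0 in ek.
- by right; apply/IH; exists k => //; rewrite big_ord_recl addrA in ek.
Qed.

End coin_flips.

(** * Expectations of functions of finitely many indicators *)

Section hits_expectation.
Context d (T : measurableType d) (R : realType) (P : probability T R).
Variables (Delta p : R) (Phi : T -> set R) (t : nat -> {RV P >-> R}).
Hypotheses (Delta0 : 0 < Delta) (p0 : 0 < p).
Hypothesis model : page_crawl_model Delta p Phi t.
Local Notation hit := (hit Phi t).
Local Notation q := (hit_prob Delta p true).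

Lemma hit_prob_false : hit_prob Delta p false = 1 - q.
Proof. by rewrite /hit_prob; field; rewrite gt_eqF// addr_gt0. Qed.

Lemma hit_prob_itv : 0 <= q <= 1.
Proof.
have D0 : 0 < Delta + p by rewrite addr_gt0.
rewrite /hit_prob ler_pdivlMr// mul0r ler_pdivrMr// mul1r.
by rewrite (ltW Delta0) lerDl ltW.
Qed.

(** The event is a finite union, over the values of the first [j.+1] indicators, of pattern events
    covered by [prob_hits]. *)
Lemma measurable_hit j : measurable_fun [set: T] (hit j).
Proof.
apply: (measurable_fun_bool true); rewrite setTI.
rewrite (_ : _ @^-1` _ =
    \bigcup_(s in [set s : j.+1.-tuple bool | nth false s j])
      [set w | forall i, (i < j.+1)%N -> hit i w = nth false s i]).
  apply: fin_bigcup_measurable => // s _.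
  exact: (prob_hits Delta0 p0 model j.+1 (nth false s)).1.
apply/seteqP; split=> w /=.
  move=> hw; exists [tuple of mkseq (hit^~ w) j.+1] => /=.
    by rewrite nth_mkseq.
  by move=> i ij; rewrite nth_mkseq.
by move=> [s sj H]; rewrite H.
Qed.

Definition hits (m n : nat) (w : T) : seq bool :=
  mkseq (fun i => hit (m + i) w) n.

Lemma hitsS m n w : hits m n.+1 w = hit m w :: hits m.+1 n w.
Proof.
rewrite /hits /mkseq -[iota 0 n.+1]/(0%N :: iota 1 n) /= addn0; congr cons.
by rewrite (iotaDl 1 0) -map_comp; apply: eq_map => i /=; rewrite addnCA addnA.
Qed.

Lemma measurable_hits m n (F : seq bool -> R) :
  measurable_fun [set: T] (fun w => F (hits m n w)).
Proof.
elim: n m F => [|n IH] m F.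
  by rewrite (_ : (fun w => _) = cst (F [::])).
rewrite (_ : (fun w => _) = fun w => if hit m w then F (true :: hits m.+1 n w)
    else F (false :: hits m.+1 n w)).
  apply: measurable_fun_ifT; first exact: measurable_hit.
    exact: (IH m.+1 (fun s => F (true :: s))).
  exact: (IH m.+1 (fun s => F (false :: s))).
by apply/funext => w; rewrite hitsS; case: (hit m w).
Qed.

(** The prescribed prefix makes the induction on [n] work: splitting on the next indicator lengthens
    the prefix and contributes one factor of the law. *)
Lemma integral_hits_prefix m n (F : seq bool -> R) (s : nat -> bool) :
  (forall r, 0 <= F r) ->
  (\int[P]_(w in [set w | forall j, (j < m)%N -> hit j w = s j])
     (F (hits m n w))%:E =
   (\prod_(j < m) hit_prob Delta p (s j) * flipE q n F)%:E)%E.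
Proof.
elim: n m F s => [|n IH] m F s F0.
  rewrite (@integral_cst _ _ _ P _ _ (F [::])%:E); last first.
    exact: (prob_hits Delta0 p0 model m s).1.
  rewrite /= mulrC EFinM; congr (_ * _)%E.
  exact: (prob_hits Delta0 p0 model m s).2.
pose sb b j := if j == m then b else s j.
pose D b := [set w | forall j, (j < m.+1)%N -> hit j w = sb b j].
have mD b : measurable (D b) := (prob_hits Delta0 p0 model m.+1 (sb b)).1.
rewrite (_ : [set w | _] = D true `|` D false); last first.
  apply/seteqP; split=> w /=.
    move=> H; suff : D (hit m w) w by case: (hit m w); [left|right].
    move=> j; rewrite ltnS leq_eqVlt /sb => /predU1P[->|jm].
      by rewrite eqxx.
    by rewrite ltn_eqF// H.
  by move=> [H|H] j jm; rewrite H ?ltnS 1?ltnW// /sb ltn_eqF.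
rewrite ge0_integral_setU//; first last.
- rewrite disj_set2E; apply/eqP/seteqP; split=> w //= [/(_ m (ltnSn _)) e1].
  by move=> /(_ m (ltnSn _)); rewrite e1 /sb eqxx.
- by move=> w _; rewrite lee_fin.
- by apply/measurable_EFinP; apply: measurable_funTS; exact: measurable_hits.
have E b : (\int[P]_(w in D b) (F (hits m n.+1 w))%:E =
    (\prod_(j < m) hit_prob Delta p (s j) * hit_prob Delta p b *
     flipE q n (fun r => F (b :: r)))%:E)%E.
  transitivity (\int[P]_(w in D b) (F (b :: hits m.+1 n w))%:E)%E.
    apply: eq_integral => w /set_mem /(_ m (ltnSn _)).
    by rewrite hitsS => ->; rewrite /sb eqxx.
  rewrite (IH m.+1 (fun r => F (b :: r)))// big_ord_recr/= {2}/sb eqxx.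
  congr (_ * _ * _)%:E; apply: eq_bigr => j _.
  by rewrite /sb ltn_eqF.
by rewrite !E -EFinD hit_prob_false; congr _%:E; rewrite /=; ring.
Qed.

Lemma integral_hits m n (F : seq bool -> R) : (forall r, 0 <= F r) ->
  (\int[P]_w (F (hits m n w))%:E = (flipE q n F)%:E)%E.
Proof.
(* An empty prefix is used, and the first [m] flips are averaged out by letting the function drop
   them. *)
move=> F0; have := integral_hits_prefix 0 (m + n) (fun=> true)
  (F := fun r => F (drop m r)) (fun r => F0 _).
rewrite big_ord0 mul1r flipE_drop => <-.
rewrite (_ : [set w | _] = setT); last by apply/seteqP; split.
apply: eq_integral => w _; congr (F _)%:E.
rewrite /hits /mkseq -map_drop drop_iota add0n addKn.
by rewrite -[m in RHS]addn0 iotaDl -map_comp.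
Qed.

Lemma prob_hits_pred m n (A : pred (seq bool)) :
  measurable [set w | A (hits m n w)] /\
  P [set w | A (hits m n w)] = (flipE q n (fun s => (A s)%:R))%:E.
Proof.
have mA : measurable [set w | A (hits m n w)].
  have := measurable_hits m n (fun s => (A s)%:R) measurableT
    (measurable_set1 1).
  rewrite setTI; congr (measurable _); apply/seteqP; split=> w /=.
    by case: (A _) => // /esym/eqP; rewrite oner_eq0.
  by move=> ->.
split=> //; rewrite -(integral_hits m) => [|r]; last exact: ler0n.
rewrite -[X in P X]setIT -integral_indic//.
by apply: eq_integral => w _; rewrite indicE mem_setE.
Qed.

End hits_expectation.

(** * Deterministic recursions *)

(** Let [u] be [z] plus the tail of [series c]. Far out, while [|u|] exceeds [2 * d] it loses at
    least [b * d] per step; divergence of [series b] forces it down to [2 * d], and it then never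
    exceeds that level. *)
Lemma cvg0_of_contraction (R : realType) (z b c : nat -> R) :
  (forall n, z n.+1 = (1 - b n) * z n + c n) ->
  (forall n, 0 <= b n) -> (\forall n \near \oo, b n <= 1) ->
  (series b n @[n --> \oo] --> +oo) -> cvgn (series c) ->
  z n @[n --> \oo] --> 0.
Proof.
move=> zS b0 b1 bdiv ccv.
pose C n := limn (series c) - series c n.
have C0 : C n @[n --> \oo] --> 0.
  rewrite -(subrr (limn (series c))); apply: cvgB => //; exact: cvg_cst.
(* Adding the tail of the convergent series to [z] turns the noise [c] into the
   vanishing term [b * C]. *)
pose u n := z n + C n.
have uS n : u n.+1 = (1 - b n) * u n + b n * C n.
  by rewrite /u zS /C [series c n.+1]seriesSr; ring.
apply/cvgr0Pnorm_le => e e0.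
pose d := e / 3; have d0 : 0 < d by rewrite divr_gt0.
have Cd : \forall n \near \oo, `|C n| <= d by move/cvgr0Pnorm_le: C0; exact.
have [N _ HN] : \forall n \near \oo, `|C n| <= d /\ b n <= 1.
  by apply: filterS2 Cd b1 => n.
have uN n : (N <= n)%N -> `|u n.+1| <= (1 - b n) * `|u n| + b n * d.
  move=> /HN[Cn bn]; rewrite uS; apply: le_trans (ler_normD _ _) _.
  rewrite !normrM (ger0_norm (b0 n)) ger0_norm ?subr_ge0//.
  by rewrite lerD2l ler_wpM2l.
have [M NM uM] : exists2 M, (N <= M)%N & `|u M| <= 2 * d.
  apply: contrapT => nM.
  have big n : (N <= n)%N -> 2 * d < `|u n|.
    by move=> Nn; rewrite ltNge; apply/negP => un; apply: nM; exists n.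
  have dec k : `|u (N + k)%N| <= `|u N| - d * (series b (N + k)%N - series b N).
    elim: k => [|k IH]; first by rewrite addn0 subrr mulr0 subr0.
    rewrite addnS seriesSr.
    have := uN _ (leq_addr k N); have := big _ (leq_addr k N).
    have := b0 (N + k)%N; move: IH; nra.
  pose v := `|u N| / d.
  have v0 : 0 <= v by rewrite divr_ge0// ltW.
  have uv : `|u N| = v * d by rewrite /v divfK// gt_eqF.
  (* By index [N + K] the accumulated decrease is at least [|u N|], which leaves a value at most 0
     and contradicts [big]. *)
  move/cvgryPge: bdiv => /(_ (series b N + v)) [K _ HK].
  have /= big_sum := HK (N + K)%N (leq_addl _ _).
  have : 0 <= d * (series b (N + K)%N - (series b N + v)).
    by rewrite mulr_ge0 ?subr_ge0// ltW.
  have := dec K; have := big _ (leq_addr K N); rewrite uv; lra.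
have uM2 k : `|u (M + k)%N| <= 2 * d.
  elim: k => [|k IH]; first by rewrite addn0.
  rewrite addnS.
  have NMk : (N <= M + k)%N by exact: leq_trans NM (leq_addr _ _).
  apply: le_trans (uN _ NMk) _.
  have [_ b1k] := HN _ NMk; have := b0 (M + k)%N; nra.
exists M => // n /= Mn.
have -> : z n = u n - C n by rewrite /u addrK.
apply: le_trans (ler_normB _ _) _.
have [Cn _] := HN _ (leq_trans NM Mn).
have := uM2 (n - M)%N; rewrite subnKC// => un.
have -> : e = 2 * d + d by rewrite /d; field.
exact: lerD.
Qed.

Lemma powRN_le_near (R : realType) (g e : R) : 0 < g -> 0 < e ->
  \forall k \near \oo, k.+1%:R `^ (- g) <= e.
Proof.
move=> g0 e0.
pose M := e `^ (- g^-1).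
have M0 : 0 < M by rewrite powR_gt0.
have ME : M `^ (- g) = e by rewrite -powRrM mulrNN mulVf ?gt_eqF// powRr1// ltW.
near=> k.
have Mk : M <= k.+1%:R.
  apply: (@le_trans _ _ k%:R); last by rewrite ler_nat.
  by near: k; exact: nbhs_infty_ger.
rewrite -ME !powRN lef_pV2 ?posrE ?powR_gt0//.
by rewrite ge0_ler_powR// ?nnegrE ltW.
Unshelve. all: by end_near. Qed.

Lemma powR_ge_self (R : realType) (u g : R) : 0 < u -> u <= 1 -> g <= 1 ->
  u <= u `^ g.
Proof.
move=> u0 u1 g1; rewrite -[leLHS](powRr1 (ltW u0)).
by rewrite /powR gt_eqF// ler_expR ler_wnM2r// ln_le0.
Qed.

(* With [x = k.+1] and [eta = x^-gamma], the bound [C * eta] decreases by at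
   most [C * eta / x <= C * a/2 * eta^2] at each step. *)
Lemma sa_recursion_rate (R : realType) (a c gamma : R) (V : nat -> R) :
  0 < a -> 0 < c -> 0 < gamma -> gamma < 1 -> (forall k, 0 <= V k) ->
  let eta k := k.+1%:R `^ (- gamma) in
  (forall k, V k.+1 <=
     (1 - 2 * a * eta k + c * eta k ^+ 2) * V k + c * eta k ^+ 2) ->
  exists2 C, 0 <= C & \forall k \near \oo, V k <= C * eta k.
Proof.
move=> a0 c0 g0 g1 V0 eta VS.
have eta0 k : 0 < eta k by rewrite powR_gt0.
have a20 : 0 < a / 2 by rewrite divr_gt0.
have [N _ HN] : \forall k \near \oo,
    [/\ c * eta k <= a, a * eta k <= 1 & k.+1%:R^-1 <= a / 2 * eta k].
  have ca : 0 < a / c by rewrite divr_gt0.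
  have ia : 0 < a^-1 by rewrite invr_gt0.
  have g10 : 0 < 1 - gamma by rewrite subr_gt0.
  apply: filterS3 (powRN_le_near g0 ca) (powRN_le_near g0 ia)
    (powRN_le_near g10 a20) => k k1 k2 k3; split.
  - by rewrite mulrC -ler_pdivlMr.
  - by rewrite -ler_pdivlMl// mulr1.
  - rewrite -[k.+1%:R^-1]powR_inv1//.
    rewrite (_ : -1 = - (1 - gamma) + - gamma); last by ring.
    rewrite powRD; last by rewrite pnatr_eq0/= implybT.
    by rewrite ler_pM2r.
(* The first entry absorbs the noise, [c <= a / 2 * C]; the second starts the induction at [N]. *)
pose C := Num.max (2 * c / a) (V N / eta N).
have C1 : 2 * c / a <= C by rewrite le_max lexx.
have C0 : 0 < C by apply: lt_le_trans C1; rewrite !mulr_gt0// invr_gt0.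
exists C; first exact: ltW.
exists N => // k /= Nk; rewrite -(subnKC Nk); elim: (k - N)%N => {k Nk} [|j].
  by rewrite addn0 -ler_pdivrMr// le_max lexx orbT.
set k := (N + j)%N; rewrite addnS -/k => IH.
have [H1 H2 H3] := HN k (leq_addr _ _).
have inv_aux (x : R) : 0 < x -> 1 - x^-1 <= x / (x + 1).
  move=> x0; rewrite ler_pdivlMr ?addr_gt0// mulrBl mul1r mulrDr.
  have : 0 < x^-1 by rewrite invr_gt0.
  rewrite mulVf ?gt_eqF// mulr1; lra.
(* The ratio of consecutive steps is [(x / (x + 1)) ^ gamma], at least [x / (x + 1)] since the base
   is at most 1 and [gamma < 1]. *)
have etaS : eta k * (1 - k.+1%:R^-1) <= eta k.+1.
  set x : R := k.+1%:R; have x0 : 0 < x by [].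
  have x1 : 0 < x + 1 by rewrite addr_gt0.
  have -> : eta k.+1 = eta k * (x / (x + 1)) `^ gamma.
    have xg0 : x `^ gamma != 0 by rewrite gt_eqF ?powR_gt0.
    rewrite powRM ?invr_ge0 ?ltW// mulrA.
    rewrite -[eta k]/(x `^ (- gamma)) [x `^ (- gamma)]powRN mulVf// mul1r.
    rewrite -[(x + 1)^-1]powR_inv1 ?ltW// -powRrM mulN1r.
    by rewrite /eta /x natr1.
  rewrite ler_pM2l//; apply: le_trans (powR_ge_self _ _ (ltW g1)).
  - exact: inv_aux.
  - by rewrite divr_gt0.
  - by rewrite ler_pdivrMr// mul1r lerDl.
have cC : c <= a / 2 * C.
  rewrite [leLHS](_ : c = a / 2 * (2 * c / a)); first by rewrite ler_pM2l.
  by field; rewrite gt_eqF.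
have E0 := eta0 k; move: (eta k) (eta k.+1) E0 IH H1 H2 H3 etaS (VS k) (V0 k).
move=> y y' y0 Vy H1 H2 H3 yy' Vs Vk.
apply: le_trans Vs _.
(* Half of the contraction pays for the quadratic term, as [c * y <= a]. Adding [q2] leaves
   [C * (y - a / 2 * y ^+ 2)], which is at most [C * y']. *)
have q1 : (1 - 2 * a * y + c * y ^+ 2) * V k <= (1 - a * y) * (C * y).
  apply: (@le_trans _ _ ((1 - a * y) * V k)).
    apply: ler_wpM2r => //; nra.
  by apply: ler_wpM2l => //; lra.
have q2 : c * y ^+ 2 <= a / 2 * C * y ^+ 2.
  by rewrite ler_wpM2r// exprn_ge0// ltW.
have q3 : y - a / 2 * y ^+ 2 <= y'.
  apply: le_trans yy'; rewrite mulrBr mulr1 lerD2l lerN2 expr2 mulrA.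
  by rewrite [leRHS]mulrC ler_pM2l.
have q4 : C * (y - a / 2 * y ^+ 2) <= C * y' by rewrite ler_pM2l.
lra.
Qed.

Lemma square_summable_tail (R : realType) (eta : nat -> R) (e : R) : 0 < e ->
  (\sum_(0 <= k <oo) ((eta k) ^+ 2)%:E < +oo)%E ->
  exists m, forall n, \sum_(i < n) eta (m + i)%N ^+ 2 <= e.
Proof.
move=> e0 sq.
have sq0 k : (0 <= (eta k ^+ 2)%:E)%E by rewrite lee_fin sqr_ge0.
have := nneseries_tail_cvg sq (fun k _ => sq0 k).
move=> /fine_cvgP[fin /cvgr_le/(_ _ e0) le_e].
have [m _ /(_ m (leqnn m)) [fm em]] := filterI fin le_e.
exists m => n; rewrite -lee_fin -sumEFin.
apply: le_trans (_ : (\sum_(m <= k <oo) (eta k ^+ 2)%:E <= _)%E); last first.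
  by rewrite -[leLHS]fineK// lee_fin.
rewrite -(nneseries_addn m)//.
apply: le_trans (nneseries_lim_ge n _) => //.
rewrite big_mkord le_eqVlt; apply/orP; left; apply/eqP/eq_bigr => i _.
by rewrite addnC.
Qed.

Lemma square_summable_cvg0 (R : realType) (eta : nat -> R) :
  (\sum_(0 <= k <oo) ((eta k) ^+ 2)%:E < +oo)%E -> eta k @[k --> \oo] --> 0.
Proof.
move=> sq; apply/cvgr0Pnorm_le => e e0.
have [m Hm] := square_summable_tail (exprn_gt0 2 e0) sq.
(* With [n - m + 1] terms, the last one is [eta n ^+ 2]. *)
exists m => // n /= mn; have := Hm (n - m).+1; rewrite big_ord_recr/= subnKC//.
have : 0 <= \sum_(i < n - m) eta (m + i)%N ^+ 2.
  by rewrite sumr_ge0// => i _; exact: sqr_ge0.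
move=> s0 sn; have : `|eta n| ^+ 2 <= e ^+ 2.
  by rewrite real_normK ?num_real//; lra.
by rewrite ler_sqr// nnegrE ltW.
Qed.

Lemma series_cvg_pinfty (R : realType) (eta : nat -> R) :
  (forall k, 0 <= eta k) ->
  (\sum_(0 <= k <oo) (eta k)%:E = +oo)%E -> series eta n @[n --> \oo] --> +oo.
Proof.
move=> eta0 sum_oo; apply/cvgeryP; rewrite -sum_oo.
rewrite [X in X @ _ --> _](_ : _ = eseries (EFin \o eta)); last first.
  by apply/funext => n; rewrite /eseries/= sumEFin.
by apply: is_cvg_nneseries => k _ _; rewrite lee_fin.
Qed.

(** * The estimator *)

Lemma eq_sa_estimator (R : realType) (p : R) (eta : nat -> R) (y0 : R)
    (I J : nat -> R) n : (forall j, (j < n)%N -> I j.+1 = J j.+1) ->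
  sa_estimator p eta y0 I n = sa_estimator p eta y0 J n.
Proof.
elim: n => [//|n IH] IJ /=; rewrite IJ// IH// => j jn.
by apply: IJ; exact: ltnW.
Qed.

(** The estimator as a function of the flips alone. Indicators are numbered from 1 and list entries
    from 0, hence [j.-1]. *)
Definition sa_flips (R : realType) (p : R) (eta : nat -> R) (y0 : R)
    (s : seq bool) : R :=
  sa_estimator p eta y0 (fun j => (nth false s j.-1)%:R) (size s).

Lemma sa_flips_rcons (R : realType) (p : R) (eta : nat -> R) (y0 : R) s b :
  let y := sa_flips p eta y0 s in
  sa_flips p eta y0 (rcons s b) = y + eta (size s) * (b%:R * (y + p) - y).
Proof.
rewrite /sa_flips size_rcons /= nth_rcons ltnn eqxx.
rewrite (@eq_sa_estimator _ _ _ _ _ (fun j => (nth false s j.-1)%:R))// => j js.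
by rewrite nth_rcons js.
Qed.

(** * The noise series and almost sure convergence *)

Section sa_model.
Context d (T : measurableType d) (R : realType) (P : probability T R).
Variables (Delta p : R) (Phi : T -> set R) (t : nat -> {RV P >-> R}).
Hypotheses (Delta0 : 0 < Delta) (p0 : 0 < p).
Hypothesis model : page_crawl_model Delta p Phi t.
Local Notation hit := (hit Phi t).
Local Notation hits := (hits Phi t).
Local Notation q := (hit_prob Delta p true).

Lemma change_indicatorE k w : change_indicator Phi t k.+1 w = (hit k w)%:R.
Proof.
rewrite /change_indicator indicE; congr (_%:R).
Qed.

Lemma sa_estimator_hits eta y0 n w :
  sa_estimator p eta y0 (change_indicator Phi t ^~ w) n =
  sa_flips p eta y0 (hits 0 n w).
Proof.
rewrite /sa_flips size_mkseq; apply: eq_sa_estimator => j jn.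
by rewrite change_indicatorE nth_mkseq.
Qed.

Definition exceeds_event (eta : nat -> R) (eps : R) (m : nat) : set T :=
  \bigcup_n [set w | exceeds q eps 0 (fun i => eta (m + i)%N) (hits m n w)].

Lemma measurable_exceeds_event eta eps m :
  measurable (exceeds_event eta eps m).
Proof.
apply: bigcup_measurable => n _.
exact: (prob_hits_pred Delta0 p0 model m n (exceeds q eps 0 _)).1.
Qed.

(** Kolmogorov's bound is uniform in the horizon [n], so it survives the increasing union by
    continuity from below. *)
Lemma prob_exceeds_event_le (eta : nat -> R) m (eps S : R) : 0 < eps ->
  (forall n, \sum_(i < n) eta (m + i)%N ^+ 2 <= S) ->
  (P (exceeds_event eta eps m) <= (S / eps ^+ 2)%:E)%E.
Proof.
move=> e0 etaS; have mU := measurable_exceeds_event eta eps m.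
set A := fun n =>
  [set w | exceeds q eps 0 (fun i => eta (m + i)%N) (hits m n w)].
have AP n := prob_hits_pred Delta0 p0 model m n
  (exceeds q eps 0 (fun i => eta (m + i)%N)).
have mA n : measurable (A n) := (AP n).1.
have homoA : {homo A : n k / (n <= k)%N >-> (n <= k)%O}.
  move=> n k nk; apply/subsetPset => w /exceedsP[i ni ei].
  by apply/exceedsP; exists i => //; exact: leq_trans nk.
have cvA := @nondecreasing_cvg_mu _ _ _ P _ mA mU homoA.
rewrite /exceeds_event -/A.
rewrite -(cvg_lim (@ereal_hausdorff R) cvA).
apply: lime_le; first by apply/cvg_ex; exists (P (\bigcup_n A n)).
apply: nearW => n; rewrite /=.
apply: le_trans (_ : ((flipE q n
  (fun s => (exceeds q eps 0 (fun i => eta (m + i)%N) s)%:R))%:E <= _)%E).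
  by have -> := (AP n).2.
rewrite lee_fin; have q01 := hit_prob_itv Delta0 p0.
apply: le_trans (flipE_exceeds q01 _ _ _ e0) _.
rewrite ler_pM2r ?invr_gt0 ?exprn_gt0// expr0n add0r.
have /andP[q0 q1] := q01.
have S0 : 0 <= \sum_(i < n) eta (m + i)%N ^+ 2.
  by rewrite sumr_ge0// => i _; exact: sqr_ge0.
by apply: le_trans (etaS n); nra.
Qed.

(** The paths on which, for some level [1 / (j + 1)], the noise restarted at every [m] reaches that
    level form a null set. On any other path, the partial sums after a good [m] stay close to their
    value at [m], hence are Cauchy. *)
Lemma ae_cvg_noise (eta : nat -> R) :
  (\sum_(0 <= k <oo) ((eta k) ^+ 2)%:E < +oo)%E ->
  {ae P, forall w, cvgn (series (fun i => eta i * ((hit i w)%:R - q)))}.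
Proof.
move=> sq.
have e0 j : 0 < (j.+1%:R^-1 : R) by rewrite invr_gt0.
pose B (j m : nat) := exceeds_event eta j.+1%:R^-1 m.
have mB j m : measurable (B j m) by exact: measurable_exceeds_event.
have Bj0 j : P.-negligible (\bigcap_m B j m).
  apply/negligibleP; first exact: bigcap_measurable.
  apply/eqP; rewrite eq_le measure_ge0 andbT; apply/lee_addgt0Pr => e e_gt0.
  rewrite add0e.
  (* The maximal inequality divides the tail by the squared level, so this threshold yields a
     probability at most [e]. *)
  have d0 : 0 < e * (j.+1%:R^-1) ^+ 2 by rewrite mulr_gt0 ?exprn_gt0.
  have [m Hm] := square_summable_tail d0 sq.
  have Pm := prob_exceeds_event_le (e0 j) Hm.
  apply: le_trans (le_trans _ Pm) _.
    apply: le_measure; rewrite ?inE; first exact: bigcap_measurable.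
      exact: mB.
    by move=> x; exact.
  by rewrite lee_fin mulfK// gt_eqF// exprn_gt0.
apply: negligibleS (negligible_bigcup Bj0) => w /= ncv.
apply: contrapT => nbad; apply: ncv.
apply/cauchy_cvgP/cauchy_exP => e ee0.
have [j je] : exists j : nat, j.+1%:R^-1 < e.
  have : \forall j \near \oo, j.+1%:R^-1 < e.
    by apply: cvgr_lt ee0; exact: cvg_harmonic.
  by move=> [N _ HN]; exists N; exact: HN (leqnn N).
have [m Hm] : exists m, ~ B j m w.
  apply: contrapT => H; apply: nbad; exists j => // m _.
  by apply: contrapT => Bm; apply: H; exists m.
exists (series (fun i => eta i * ((hit i w)%:R - q)) m).
exists m => // n /= mn; rewrite -ball_normE /=; apply: lt_trans je.
rewrite distrC ltNge; apply/negP => H; apply: Hm.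
exists (n - m)%N => //=; apply/exceedsP; exists (n - m)%N => //.
rewrite add0r; apply: le_trans H _.
rewrite -{1}(subnK mn) series_addn addrC addKr subnK//.
rewrite -{1}[m]add0n big_addn big_mkord le_eqVlt; apply/orP; left; apply/eqP.
by congr (`|_|); apply: eq_bigr => i _; rewrite addnC.
Qed.

Lemma ae_cvg_sa (eta : nat -> R) (y0 : R) : (forall k, 0 < eta k) ->
  (\sum_(0 <= k <oo) (eta k)%:E = +oo)%E ->
  (\sum_(0 <= k <oo) ((eta k) ^+ 2)%:E < +oo)%E ->
  {ae P, forall w,
    sa_estimator p eta y0 (change_indicator Phi t ^~ w) k @[k --> \oo]
      --> Delta}.
Proof.
move=> eta0 eta_oo sq; have D0 : Delta + p != 0 by rewrite gt_eqF// addr_gt0.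
apply: filterS (ae_cvg_noise sq) => w cvS.
set noise := fun i => _ in cvS.
pose y k := sa_estimator p eta y0 (change_indicator Phi t ^~ w) k.
pose b k := eta k * (1 - (hit k w)%:R).
have q1 : 0 < 1 - q.
  rewrite /hit_prob (_ : 1 - _ = p / (Delta + p)); last by field.
  by rewrite divr_gt0 ?addr_gt0.
have z0 : y k - Delta @[k --> \oo] --> 0.
  apply: (@cvg0_of_contraction _ _ b (fun k => (Delta + p) * noise k)).
  - move=> k; rewrite /y /= change_indicatorE /b /noise /hit_prob.
    by field.
  - by move=> k; rewrite mulr_ge0 ?(ltW (eta0 k))//; case: (hit k w);
      rewrite ?subrr ?subr0.
  (* Square summability sends [eta] to 0, so the contraction factors are eventually nonnegative. *)
  - have : \forall k \near \oo, eta k < 1.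
      by apply: cvgr_lt; [exact: square_summable_cvg0|exact: ltr01].
    apply: filterS => k k1; apply: le_trans (ltW k1).
    by rewrite ler_piMr ?(ltW (eta0 k))// gerBl.
  - have E : series b = (fun n => (1 - q) * series eta n - series noise n).
      apply/funext => n; rewrite /series mulr_sumr -sumrB.
      by apply: eq_bigr => i _; rewrite /b /noise; ring.
    have div := series_cvg_pinfty (fun k => ltW (eta0 k)) eta_oo.
    have [l Sl] : exists l : R, series noise n @[n --> \oo] --> l.
      by exists (limn (series noise)).
    have near_l : \forall n \near \oo, series noise n <= l + 1.
      by apply: cvgr_le Sl _ _; rewrite ltrDl.
    rewrite E; apply/cvgryPge => A.
    move/cvgryPge: div => /(_ ((A + l + 1) / (1 - q))) div.
    apply: filterS2 div near_l => n; rewrite ler_pdivrMr// mulrC; lra.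
  - rewrite (_ : series _ = (fun n => (Delta + p) * series noise n)).
      by apply: is_cvgMr.
    by apply/funext => n; rewrite /series/= mulr_sumr.
rewrite -/y -[Delta]add0r.
rewrite (_ : y = fun k => y k - Delta + Delta); last first.
  by apply/funext => k; rewrite subrK.
by apply: cvgD => //; exact: cvg_cst.
Qed.

End sa_model.

(** * Second moment and rate of convergence *)

(** Averaging over the last flip, the cross term of order [eta] vanishes because the noise is
    centred; what remains beyond the contraction is of order [eta ^+ 2]. *)
Lemma sa_second_moment (R : realType) (Delta p gamma y0 : R) :
  0 < Delta -> 0 < p -> 0 < gamma -> gamma < 1 ->
  let eta k := k.+1%:R `^ (- gamma) in
  exists2 C, 0 <= C & \forall k \near \oo,
    flipE (hit_prob Delta p true) k
      (fun s => (sa_flips p eta y0 s - Delta) ^+ 2) <= C * eta k.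
Proof.
move=> Delta0 p0 g0 g1 eta; have Dp : 0 < Delta + p by rewrite addr_gt0.
set q := hit_prob Delta p true.
have q01 : 0 <= q <= 1 := hit_prob_itv Delta0 p0.
pose a := p / (Delta + p); pose c := a * (1 + Delta) + Delta * p.
have a0 : 0 < a by rewrite divr_gt0.
have c0 : 0 < c by apply: addr_gt0; apply: mulr_gt0 => //; exact: addr_gt0.
apply: (@sa_recursion_rate _ a c) => // [k|k].
  by rewrite -(flipE_cst q k 0); apply: le_flipE => // s _; exact: sqr_ge0.
rewrite flipE_rcons -[X in _ <= _ + X]mulr1.
rewrite -[X in _ <= _ + _ * X](flipE_cst q k 1) -flipE_lin.
apply: le_flipE => // s sk; rewrite !sa_flips_rcons sk.
set z := sa_flips p eta y0 s - Delta.
have -> : sa_flips p eta y0 s = z + Delta by rewrite subrK.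
rewrite -/(eta k); move: (eta k) z => h z.
rewrite [leLHS](_ : _ = (1 - 2 * a * h + a * h ^+ 2) * z ^+ 2 +
    h ^+ 2 * (2 * (Delta * a) * z + Delta * p)); last first.
  by rewrite /q /hit_prob /a /=; field; rewrite gt_eqF.
have h2 : 0 <= h ^+ 2 := sqr_ge0 _.
(* The linear term in [z] is absorbed through [2 * z <= z ^+ 2 + 1]; the constant [c] is chosen so
   that the difference is a sum of nonnegative terms. *)
rewrite -subr_ge0 [leRHS](_ : _ =
   h ^+ 2 * (Delta * a * (z - 1) ^+ 2 + Delta * p * z ^+ 2 + a)); last first.
  by rewrite /c; ring.
have Da0 : 0 <= Delta * a by apply: mulr_ge0; exact: ltW.
have Dp0 : 0 <= Delta * p by apply: mulr_ge0; exact: ltW.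
by rewrite mulr_ge0// addr_ge0 ?(ltW a0)// addr_ge0// mulr_ge0// sqr_ge0.
Qed.


Theorem theorem2 (R : realType) (Delta p : R) (hDelta : 0 < Delta) (hp : 0 < p) :
  (forall (d : measure_display) (T : measurableType d) (P : probability T R)
      (Phi : T -> set R) (t : nat -> {RV P >-> R})
      (hmodel : page_crawl_model Delta p Phi t)
      (eta : nat -> R) (heta : forall k, 0 < eta k) (y0 : R),
    (\sum_(0 <= k <oo) (eta k)%:E = +oo)%E ->
    (\sum_(0 <= k <oo) ((eta k) ^+ 2)%:E < +oo)%E ->
    {ae P, forall w,
      sa_estimator p eta y0 (change_indicator Phi t ^~ w) k @[k --> \oo]
        --> Delta})
  /\
  (forall (gamma : R) (hgamma0 : 0 < gamma) (hgamma1 : gamma < 1) (y0 : R),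
    exists C : R, \forall k \near \oo,
      forall (d : measure_display) (T : measurableType d) (P : probability T R)
        (Phi : T -> set R) (t : nat -> {RV P >-> R})
        (hmodel : page_crawl_model Delta p Phi t),
      let eta := fun j : nat => 1 / (j.+1%:R `^ gamma) in
      ('E_P[fun w =>
            `|sa_estimator p eta y0 (change_indicator Phi t ^~ w) k - Delta|%R]
        <= (C * k%:R `^ (- (gamma / 2)))%:E)%E).
Proof.
split=> [d T P Phi t model eta eta0 y0 eta_oo sq|gamma g0 g1 y0].
  exact: ae_cvg_sa.
have [C C0 [N _ HN]] := sa_second_moment y0 hDelta hp g0 g1.
(* The constant comes from [C * e ^+ 2 / (2 * e) + e / 2], where [e] is the target rate; [maxn N 1]
   excludes [k = 0] to keep [e] positive. *)
exists ((C + 1) / 2); exists (maxn N 1) => // k /=.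
rewrite geq_max => /andP[Nk k0] d T P Phi t model.
rewrite (_ : (fun j => _) = fun j => j.+1%:R `^ (- gamma)); last first.
  by apply/funext => j; rewrite div1r powRN.
pose eta (j : nat) : R := j.+1%:R `^ (- gamma); rewrite -/eta.
have q01 := hit_prob_itv hDelta hp.
set q := hit_prob Delta p true in q01.
pose e := k%:R `^ (- (gamma / 2)) : R.
have kR0 : 0 < k%:R :> R by rewrite ltr0n.
have e0 : 0 < e by rewrite powR_gt0.
have eE : k%:R `^ (- gamma) = e ^+ 2.
  by rewrite -powR_mulrn ?ltW// -powRrM; congr (_ `^ _); field.
(* The second moment bound is in terms of [k.+1]; a negative power only increases when [k.+1] is
   replaced by [k]. *)
have Vk : flipE q k (fun s => (sa_flips p eta y0 s - Delta) ^+ 2) <= C * e ^+ 2.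
  apply: le_trans (HN k Nk) _; apply: ler_wpM2l => //.
  rewrite -eE !powRN lef_pV2 ?posrE ?powR_gt0//.
  by rewrite ge0_ler_powR ?nnegrE ?ltW// ltr_nat.
rewrite unlock.
under eq_integral do rewrite sa_estimator_hits.
rewrite (integral_hits hDelta hp model 0 k
  (F := fun s => `|sa_flips p eta y0 s - Delta|))// lee_fin.
(* AM-GM: [|z| <= (z^2 / e + e) / 2] with [e = k^(-gamma/2)]. *)
have AMGM : flipE q k (fun s => `|sa_flips p eta y0 s - Delta|) <=
    flipE q k (fun s => (2 * e)^-1 * (sa_flips p eta y0 s - Delta) ^+ 2 +
      e / 2 * 1).
  apply: le_flipE => // s _; set z := _ - Delta.
  rewrite -real_normK ?num_real// -subr_ge0.
  rewrite (_ : _ - _ = (2 * e)^-1 * (`|z| - e) ^+ 2).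
    by rewrite mulr_ge0 ?sqr_ge0// invr_ge0 mulr_ge0// ltW.
  by field; rewrite gt_eqF.
apply: le_trans AMGM _; rewrite flipE_lin flipE_cst mulr1.
apply: le_trans (lerD (ler_wpM2l _ Vk) (lexx _)) _.
  by rewrite invr_ge0 mulr_ge0// ltW.
rewrite le_eqVlt; apply/orP; left; apply/eqP.
by rewrite -/e; field; rewrite gt_eqF.
Qed.
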